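(* Let $C\ge 2$ and let $\mathcal L$ be either the Sparsemax loss or the $\alpha$-Entmax loss ($\alpha>1$) on $\{0,1\}^C\times\mathbb R^C$. Then for every integer $k$ with $1<k\le C$ the loss $\mathcal L$ is Top-$k$ calibrated, and $\mathcal L$ is DCG-consistent.
   Context: $\Delta^C=\{p\in\mathbb R^C: p_i\ge 0,\ \sum_i p_i=1\}$. For a convex function $\Omega:\Delta^C\to\mathbb R$, put $\Omega^*(s)=\sup_{p\in\Delta^C}\{\langle s,p\rangle-\Omega(p)\}$ for $s\in\mathbb R^C$. The Fenchel–Young loss of $\Omega$ is $\mathcal L_\Omega(y,s)=\Omega^*(s)+\Omega(y)-\langle s,y\rangle$, where $y$ is a one-hot label vector, and its prediction mapping is $\hat p(s)=\nabla\Omega^*(s)\in\Delta^C$. The Sparsemax loss is $\mathcal L_\Omega$ with $\Omega(p)=\tfrac12\|p\|_2^2$; its prediction mapping is $\hat p_i(s)=\max\{s_i-\tau(s),0\}$ with $\tau(s)$ chosen so that $\sum_i\hat p_i(s)=1$. The $\alpha$-Entmax loss is $\mathcal L_\Omega$ with the Tsallis (negative) entropy $\Omega(p)=\frac{1}{\alpha(\alpha-1)}\sum_i(p_i^\alpha-p_i)$; its prediction mapping is $\hat p_i(s)=\big((\alpha-1)(s_i-\tau(s))_+\big)^{1/(\alpha-1)}$ with $\tau(s)$ chosen so that $\sum_i\hat p_i(s)=1$. For $p\in\Delta^C$, the conditional risk of $s$ is $\mathbb E_{y\sim p}[\mathcal L(y,s)]$, where $y=e_i$ (the $i$-th standard basis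 vector) with probability $p_i$. For $v\in\mathbb R^C$, $\operatorname{Top}_k(v)$ denotes a set of $k$ indices of largest components of $v$ (ties broken arbitrarily). Top-$k$ calibrated: for every $p\in\Delta^C$ and every minimizer $s^*\in\mathbb R^C$ of the conditional risk, $\operatorname{Top}_k(s^* )$ (under any tie-breaking) is Bayes-optimal for the top-$k$ error, i.e. it minimizes over $k$-element sets $A\subseteq\{1,\dots,C\}$ the probability $\mathbb P_{i\sim p}(i\notin A)$. DCG-consistent: for every $p\in\Delta^C$ and every minimizer $s^*$ of the conditional risk, every permutation $\pi$ sorting $s^*$ in non-increasing order maximizes the expected DCG, $\sum_{i=1}^C \frac{p_{\pi(i)}}{\log_2(i+1)}$, over all permutations of $\{1,\dots,C\}$. *)

(* Defs.v *)
From HB Require Import structures.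
From mathcomp Require Import all_boot all_order all_fingroup all_algebra.
From mathcomp Require Import classical_sets reals exp.

Set Implicit Arguments.
Unset Strict Implicit.
Unset Printing Implicit Defensive.

Import Order.TTheory GRing.Theory Num.Theory.
Local Open Scope classical_set_scope.
Local Open Scope ring_scope.

Definition prob_simplex (R : realType) (C : nat) : set 'rV[R]_C :=
  [set p | (forall i, 0 <= p 0 i) /\ \sum_i p 0 i = 1].
Arguments prob_simplex : clear implicits.

Definition dotv (R : realType) (C : nat) (u v : 'rV[R]_C) : R :=
  \sum_i u 0 i * v 0 i.

(* A regularizer Omega is a total function of which only the values on the
   simplex matter. [sup] is the real supremum, with value 0 on sets that are
   empty or unbounded above; neither happens for C > 0 and Omega bounded below
   on the simplex. *)
Definition conjugate (R : realType) (C : nat) (Omega : 'rV[R]_C -> R)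
    (s : 'rV[R]_C) : R :=
  sup [set dotv s p - Omega p | p in prob_simplex R C].

Definition fenchel_young_loss (R : realType) (C : nat) (Omega : 'rV[R]_C -> R)
    (y s : 'rV[R]_C) : R :=
  conjugate Omega s + Omega y - dotv s y.

Definition half_sqnorm (R : realType) (C : nat) (p : 'rV[R]_C) : R :=
  2^-1 * \sum_i p 0 i ^+ 2.

Definition tsallis (R : realType) (C : nat) (alpha : R) (p : 'rV[R]_C) : R :=
  (alpha * (alpha - 1))^-1 * \sum_i (p 0 i `^ alpha - p 0 i).

Definition sparsemax_loss (R : realType) (C : nat) : 'rV[R]_C -> 'rV[R]_C -> R :=
  fenchel_young_loss (@half_sqnorm R C).

Definition entmax_loss (R : realType) (C : nat) (alpha : R) :
    'rV[R]_C -> 'rV[R]_C -> R :=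
  fenchel_young_loss (@tsallis R C alpha).

(* [delta_mx 0 i] is the one-hot row vector e_i. *)
Definition cond_risk (R : realType) (C : nat) (L : 'rV[R]_C -> 'rV[R]_C -> R)
    (p s : 'rV[R]_C) : R :=
  \sum_i p 0 i * L (delta_mx 0 i) s.

Definition risk_minimizer (R : realType) (C : nat)
    (L : 'rV[R]_C -> 'rV[R]_C -> R) (p s : 'rV[R]_C) : Prop :=
  forall s' : 'rV[R]_C, cond_risk L p s <= cond_risk L p s'.

(* A is a possible value of Top_k(v) for some way of breaking ties. *)
Definition is_topk (R : realType) (C k : nat) (v : 'rV[R]_C)
    (A : {set 'I_C}) : Prop :=
  #|A| = k /\ (forall i j, i \in A -> j \notin A -> v 0 j <= v 0 i).

Definition topk_error (R : realType) (C : nat) (p : 'rV[R]_C)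
    (A : {set 'I_C}) : R :=
  \sum_(i | i \notin A) p 0 i.

Definition topk_bayes_optimal (R : realType) (C k : nat) (p : 'rV[R]_C)
    (A : {set 'I_C}) : Prop :=
  #|A| = k /\
  (forall B : {set 'I_C}, #|B| = k -> topk_error p A <= topk_error p B).

Definition topk_calibrated (R : realType) (C k : nat)
    (L : 'rV[R]_C -> 'rV[R]_C -> R) : Prop :=
  forall p s : 'rV[R]_C, prob_simplex R C p -> risk_minimizer L p s ->
  forall A : {set 'I_C}, is_topk k s A -> topk_bayes_optimal k p A.

Definition log2 (R : realType) (x : R) : R := ln x / ln 2.

(* Ranks in 'I_C start at 0, so the discount log2 (i + 1) of the 1-based rank i
   becomes log2 (i + 2). *)
Definition expected_dcg (R : realType) (C : nat) (p : 'rV[R]_C)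
    (pi : 'S_C) : R :=
  \sum_(i < C) p 0 (pi i) / log2 (i.+2%:R).

Definition sorts_nonincreasing (R : realType) (C : nat) (v : 'rV[R]_C)
    (pi : 'S_C) : Prop :=
  forall i j : 'I_C, (i <= j)%N -> v 0 (pi j) <= v 0 (pi i).

Definition dcg_consistent (R : realType) (C : nat)
    (L : 'rV[R]_C -> 'rV[R]_C -> R) : Prop :=
  forall p s : 'rV[R]_C, prob_simplex R C p -> risk_minimizer L p s ->
  forall pi : 'S_C, sorts_nonincreasing s pi ->
  forall rho : 'S_C, expected_dcg p rho <= expected_dcg p pi.

(* Main.v *)
(* Up to a constant, the conditional risk of s is Omega^*(s) - <s, p>, and both
   regularizers are symmetric and uniformly convex along coordinate averaging.
   Hence a minimizer s cannot satisfy s_j <= s_i when p_i < p_j: levelling s_i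
   and s_j and then moving a little mass from i to j would lower the risk. So
   every ordering of the scores, ties included, orders p correctly, and both
   claims become statements about sums over sets of largest entries of p. *)
Require Import Defs.
From mathcomp Require Import all_boot all_order all_fingroup all_algebra.
From mathcomp Require Import classical_sets reals exp.
From mathcomp Require Import ring lra.

Set Implicit Arguments.
Unset Strict Implicit.
Unset Printing Implicit Defensive.

Import Order.TTheory GRing.Theory Num.Theory.
Local Open Scope ring_scope.

(** * Uniform midpoint convexity of the two entropies *)

(* [x `^ (alpha - 1) >= 1 + (alpha - 1) * ln x] reduces the claim to a lower
   bound on [x * ln x], which follows from [ln y >= 1 - y^-1] at
   [y = Num.sqrt x]. *)
Lemma powR_ge_tangent_quadratic (R : realType) (alpha x : R) :
  1 < alpha -> 0 <= x <= 2 ->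
  1 + alpha * (x - 1) + (alpha - 1) / 9 * (x - 1) ^+ 2 <= x `^ alpha.
Proof.
move=> a1 /andP[x0 x2].
have [->|xn0] := eqVneq x 0.
  by rewrite powR0; [nra | rewrite gt_eqF // (lt_trans ltr01)].
have xp : 0 < x by rewrite lt_neqAle eq_sym xn0.
pose y := Num.sqrt x.
have yp : 0 < y by rewrite sqrtr_gt0.
have xE : x = y ^+ 2 by rewrite sqr_sqrtr.
have lny : y * (1 - ln y) <= 1.
  have : 1 - ln y <= y^-1.
    by rewrite -[X in _ <= X^-1](lnK yp) -expRN expR_ge1Dx.
  by move/(ler_wpM2l (ltW yp)); rewrite divff // gt_eqF.
have lnx : ln x = 2 * ln y by rewrite xE expr2 lnM ?posrE //; ring.
have powx : x * (1 + (alpha - 1) * ln x) <= x `^ alpha.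
  rewrite -mulr_powRB1 ?(lt_trans ltr01)// ler_pM2l//.
  by rewrite /powR (negbTE xn0) expR_ge1Dx.
apply: le_trans powx; rewrite lnx xE.
have y2 : y <= 2 by nra.
(* The constant 9 bounds [(y + 1) ^+ 2], since [y <= 2]. *)
have key : (y ^+ 2 - 1) ^+ 2 <= 9 * (y - 1) ^+ 2.
  have -> : (y ^+ 2 - 1) ^+ 2 = (y + 1) ^+ 2 * (y - 1) ^+ 2 by ring.
  by apply: ler_wpM2r; [exact: sqr_ge0 | nra].
have l2 : y * (y * (1 - ln y)) <= y * 1 by rewrite ler_pM2l.
have b0 : 0 < alpha - 1 by lra.
rewrite -subr_ge0.
have -> : y ^+ 2 * (1 + (alpha - 1) * (2 * ln y)) -
  (1 + alpha * (y ^+ 2 - 1) + (alpha - 1) / 9 * (y ^+ 2 - 1) ^+ 2) =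
  (alpha - 1) * (2 * (y * 1 - y * (y * (1 - ln y))) +
     ((y - 1) ^+ 2 - (y ^+ 2 - 1) ^+ 2 / 9)) by field.
apply: mulr_ge0; lra.
Qed.

(** Strict midpoint convexity on [0, 1], made uniform: [c] depends only on the separation [d], so it
    can be fixed before the competitors in the conjugate are considered. *)
Definition midpoint_gap (R : realType) (phi : R -> R) : Prop :=
  forall d : R, 0 < d -> exists2 c : R, 0 < c &
    forall a b, 0 <= a <= 1 -> 0 <= b <= 1 -> d <= a - b ->
      2 * phi ((a + b) / 2) + c <= phi a + phi b.

Lemma midpoint_gap_sqr (R : realType) :
  midpoint_gap (fun x : R => 2^-1 * x ^+ 2).
Proof.
move=> d d0; exists (d ^+ 2 / 4); first by rewrite divr_gt0 // exprn_gt0.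
by move=> a b _ _ dab; nra.
Qed.

(** Write [a] and [b] as [m * (1 + u)] and [m * (1 - u)]. In the tangent bounds at [1 + u] and
    [1 - u] the linear terms cancel and the quadratic ones add up; [m] and [u] are both at least
    [h = d / 2], which gives the constant [c]. *)
Lemma midpoint_gap_tsallis (R : realType) (alpha : R) : 1 < alpha ->
  midpoint_gap (fun x => (alpha * (alpha - 1))^-1 * (x `^ alpha - x)).
Proof.
move=> a1 d d0; pose h := d / 2; have h0 : 0 < h by rewrite divr_gt0.
have k0 : 0 < (alpha * (alpha - 1))^-1.
  by rewrite invr_gt0 mulr_gt0 //; lra.
set k := _^-1 in k0 *.
pose c := h `^ alpha * (2 * ((alpha - 1) / 9 * h ^+ 2)).
have c0 : 0 < c.
  rewrite mulr_gt0 ?powR_gt0// mulr_gt0// mulr_gt0 ?exprn_gt0// divr_gt0//.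
  lra.
exists (k * c) => [|a b /andP[a0 a1'] /andP[b0 b1] dab]; first exact: mulr_gt0.
set m := (a + b) / 2; have mE : m = (a + b) / 2 by []; clearbody m.
have hm : h <= m by rewrite /h; lra.
have m1 : m <= 1 by lra.
have m0 : 0 < m := lt_le_trans h0 hm.
pose u := (a - b) / 2 / m.
have mu : m * u = (a - b) / 2 by rewrite mulrC divfK ?gt_eqF.
have hu : h <= u by rewrite ler_pdivlMr //; move: m1 dab hm; rewrite /h; nra.
(* This amounts to [0 <= b]; it keeps [1 + u] and [1 - u] within [0, 2], where the tangent bound
   holds. *)
have u1 : u <= 1 by rewrite ler_pdivrMr //; lra.
have aE : a = m * (1 + u) by rewrite mulrDr mu; lra.
have bE : b = m * (1 - u) by rewrite mulrBr mu; lra.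
have u0 : 0 < u := lt_le_trans h0 hu.
have ineq : 2 * m `^ alpha + c <= a `^ alpha + b `^ alpha.
  rewrite aE bE !powRM ?(ltW m0) //; try lra.
  have Pu : 1 + alpha * (1 + u - 1) + (alpha - 1) / 9 * (1 + u - 1) ^+ 2
      <= (1 + u) `^ alpha by apply: powR_ge_tangent_quadratic => //; lra.
  have Mu : 1 + alpha * (1 - u - 1) + (alpha - 1) / 9 * (1 - u - 1) ^+ 2
      <= (1 - u) `^ alpha by apply: powR_ge_tangent_quadratic => //; lra.
  have hm' : h `^ alpha <= m `^ alpha.
    by apply: ge0_ler_powR; rewrite ?nnegrE //; lra.
  have hu2 : h ^+ 2 <= u ^+ 2 by nra.
  have q0 : 0 <= 2 * ((alpha - 1) / 9 * h ^+ 2).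
    by rewrite mulr_ge0 // mulr_ge0 ?sqr_ge0// divr_ge0//; lra.
  have cm : c <= m `^ alpha * (2 * ((alpha - 1) / 9 * h ^+ 2)).
    exact: ler_wpM2r.
  apply: (@le_trans _ _ (m `^ alpha * (2 + 2 * ((alpha - 1) / 9 * h ^+ 2)))).
    by rewrite mulrDr [_ * 2]mulrC lerD2l.
  rewrite -mulrDr; apply: ler_wpM2l; first exact: powR_ge0.
  nra.
have : k * (2 * m `^ alpha + c) <= k * (a `^ alpha + b `^ alpha).
  by rewrite ler_pM2l.
have : k * (2 * m) = k * (a + b) by congr (_ * _); lra.
lra.
Qed.

(** * Mass transfer between two coordinates of the simplex *)

Lemma dotvDl (R : realType) (C : nat) (u v w : 'rV[R]_C) :
  dotv (u + v) w = dotv u w + dotv v w.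
Proof. by rewrite -big_split; apply: eq_bigr => i _; rewrite mxE mulrDl. Qed.

Lemma dotvDr (R : realType) (C : nat) (u v w : 'rV[R]_C) :
  dotv u (v + w) = dotv u v + dotv u w.
Proof. by rewrite -big_split; apply: eq_bigr => i _; rewrite mxE mulrDr. Qed.

Lemma dotv_delta (R : realType) (C : nat) (u : 'rV[R]_C) i :
  dotv u (delta_mx 0 i) = u 0 i.
Proof.
rewrite /dotv (bigD1 i) //= big1 ?mxE ?eqxx ?mulr1 ?addr0 // => j ji.
by rewrite mxE (negbTE ji) mulr0.
Qed.

Definition transfer (R : realType) (C : nat) (i j : 'I_C) (u : R) : 'rV[R]_C :=
  u *: (delta_mx 0 j - delta_mx 0 i).

Lemma dotv_transferr (R : realType) (C : nat) (i j : 'I_C) u (s : 'rV[R]_C) :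
  dotv s (transfer i j u) = u * (s 0 j - s 0 i).
Proof.
rewrite -!(dotv_delta s) /dotv -sumrB mulr_sumr.
by apply: eq_bigr => k _; rewrite !mxE; ring.
Qed.

Lemma dotvC (R : realType) (C : nat) (u v : 'rV[R]_C) : dotv u v = dotv v u.
Proof. by apply: eq_bigr => i _; rewrite mulrC. Qed.

Lemma simplex_le1 (R : realType) (C : nat) (p : 'rV[R]_C) i :
  prob_simplex R C p -> 0 <= p 0 i <= 1.
Proof.
move=> [p0 p1]; rewrite p0 /= -p1 (bigD1 i) //= lerDl.
by apply: sumr_ge0 => j _.
Qed.

(** Phrased as a transfer so that pairing with scores follows by linearity. *)
Definition averaged (R : realType) (C : nat) (i j : 'I_C) (q : 'rV[R]_C) :=
  q + transfer i j ((q 0 i - q 0 j) / 2).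

Lemma averagedE (R : realType) (C : nat) (i j : 'I_C) (q : 'rV[R]_C) k :
  i != j -> averaged i j q 0 k =
    if (k == i) || (k == j) then (q 0 i + q 0 j) / 2 else q 0 k.
Proof.
move=> ij; rewrite !mxE eqxx /=.
have [->|ki] := eqVneq k i; first by rewrite (negbTE ij) /=; field.
by have [->|kj] := eqVneq k j => /=; field.
Qed.

Lemma averaged_simplex (R : realType) (C : nat) (i j : 'I_C) (q : 'rV[R]_C) :
  i != j -> prob_simplex R C q -> prob_simplex R C (averaged i j q).
Proof.
move=> ij [q0 q1]; split=> [k|].
  rewrite averagedE //; case: ifP => // _.
  by rewrite divr_ge0 // addr_ge0.
have one (w : 'rV[R]_C) : \sum_k w 0 k = dotv (const_mx 1) w.
  by apply: eq_bigr => k _; rewrite mxE mul1r.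
by rewrite one dotvDr -one q1 dotv_transferr !mxE subrr mulr0 addr0.
Qed.

(** * Order of the scores at a risk minimizer *)

Section RiskMinimizer.
Variables (R : realType) (C : nat) (phi : R -> R) (M : R).
Variable Omega : 'rV[R]_C -> R.
Hypothesis OmegaE : forall p, Omega p = \sum_i phi (p 0 i).
Hypothesis phi_ge : forall x, 0 <= x <= 1 -> M <= phi x.
Hypothesis phi_gap : midpoint_gap phi.

Lemma sum_averaged (i j : 'I_C) (q : 'rV[R]_C) : i != j ->
  Omega (averaged i j q) =
    Omega q + 2 * phi ((q 0 i + q 0 j) / 2) - (phi (q 0 i) + phi (q 0 j)).
Proof.
move=> ij; have ji : j != i by rewrite eq_sym.
rewrite !OmegaE (bigD1 i) // (bigD1 j) //= [in RHS](bigD1 i) // (bigD1 j) //=.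
rewrite !averagedE // !eqxx orbT /=.
under eq_bigr => k /andP[/negbTE ki /negbTE kj] do
  rewrite averagedE // ki kj /=.
by ring.
Qed.

Lemma averaged_le (i j : 'I_C) (q : 'rV[R]_C) : i != j ->
  prob_simplex R C q -> Omega (averaged i j q) <= Omega q.
Proof.
move=> ij qS; rewrite sum_averaged //.
have qi := simplex_le1 i qS; have qj := simplex_le1 j qS.
have [lt|gt|->] := ltgtP (q 0 i) (q 0 j).
- have [|c c0 /(_ _ _ qj qi (lexx _))] := phi_gap (d := q 0 j - q 0 i).
    by rewrite subr_gt0.
  rewrite [q 0 j + q 0 i]addrC; lra.
- have [|c c0 /(_ _ _ qi qj (lexx _))] := phi_gap (d := q 0 i - q 0 j).
    by rewrite subr_gt0.
  lra.
- have -> : (q 0 j + q 0 j) / 2 = q 0 j by field.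
  lra.
Qed.

(** The real [sup] dominates its set only if that set is bounded above: on the simplex each term is
    at most [|s_i| - M]. *)
Lemma conjugate_ub (s q : 'rV[R]_C) : prob_simplex R C q ->
  dotv s q - Omega q <= Defs.conjugate Omega s.
Proof.
move=> qS; apply: ub_le_sup; last by exists q.
exists (\sum_i (`|s 0 i| - M)) => _ [r rS <-].
rewrite OmegaE /dotv -sumrB; apply: ler_sum => i _.
have ri := simplex_le1 i rS; have /andP[r0 r1] := ri.
apply: lerB; last exact: phi_ge.
apply: le_trans (ler_norm _) _; rewrite normrM (ger0_norm r0).
by rewrite -[leRHS]mulr1 ler_wpM2l.
Qed.

Lemma conjugate_le (s : 'rV[R]_C) (b : R) (p : 'rV[R]_C) :
  prob_simplex R C p ->
  (forall q, prob_simplex R C q -> dotv s q - Omega q <= b) ->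
  Defs.conjugate Omega s <= b.
Proof.
move=> pS ub; apply: ge_sup; first by exists (dotv s p - Omega p); exists p.
by move=> _ [q qS <-]; exact: ub.
Qed.

Lemma cond_riskE (p s : 'rV[R]_C) : prob_simplex R C p ->
  cond_risk (fenchel_young_loss Omega) p s =
  Defs.conjugate Omega s - dotv s p + \sum_i p 0 i * Omega (delta_mx 0 i).
Proof.
move=> [_ p1]; rewrite /cond_risk /fenchel_young_loss.
under eq_bigr do rewrite dotv_delta mulrBr mulrDr.
rewrite sumrB big_split /= -mulr_suml p1 mul1r dotvC /dotv; lra.
Qed.

(* If [p 0 i < p 0 j] but [s 0 j <= s 0 i], levelling the two scores and then
   moving [t] from [i] to [j] gains at least [t * (p 0 j - p 0 i)] in the
   linear term, while averaging coordinates [i] and [j] of a competitor [q]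
   shows that the conjugate grows by at most half as much. *)
Lemma risk_minimizer_order (p s : 'rV[R]_C) (i j : 'I_C) :
  prob_simplex R C p -> risk_minimizer (fenchel_young_loss Omega) p s ->
  s 0 j <= s 0 i -> p 0 j <= p 0 i.
Proof.
move=> pS smin sji; rewrite leNgt; apply/negP => pij.
have ij : i != j by apply: contraTneq pij => ->; rewrite ltxx.
pose d := p 0 j - p 0 i; have d0 : 0 < d by rewrite subr_gt0.
have [|c c0 gap] := phi_gap (d := d / 2); first by rewrite divr_gt0.
(* The convexity gap [c] at separation [d / 2] doubles as the amount moved after levelling. *)
pose s' := s + transfer i j ((s 0 i - s 0 j) / 2 + c).
have conj_le : Defs.conjugate Omega s' <= Defs.conjugate Omega s + c * (d / 2).
  apply: (conjugate_le pS) => q qS.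
  have := conjugate_ub s (averaged_simplex ij qS).
  have -> : dotv s' q = dotv s (averaged i j q) + c * (q 0 j - q 0 i).
    by rewrite dotvDl dotvDr (dotvC (transfer _ _ _)) !dotv_transferr; field.
  have qi := simplex_le1 i qS; have qj := simplex_le1 j qS.
  (* If [q] separates [i] and [j] by at least [d / 2], averaging saves [c] in [Omega], which pays
     for the tilt as [q 0 j - q 0 i <= 1]. Otherwise the tilt itself is at most [c * (d / 2)]. *)
  have [big|small] := leP (d / 2) (q 0 j - q 0 i).
    have := gap _ _ qj qi big; rewrite sum_averaged // [q 0 j + q 0 i]addrC.
    have : c * (q 0 j - q 0 i) <= c * 1 by rewrite ler_pM2l //; lra.
    have : 0 < c * (d / 2) by rewrite mulr_gt0 // divr_gt0.
    lra.
  have := averaged_le ij qS.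
  have : c * (q 0 j - q 0 i) <= c * (d / 2) by rewrite ler_pM2l // ltW.
  lra.
have := smin s'; rewrite !cond_riskE // dotvDl (dotvC (transfer _ _ _)).
rewrite dotv_transferr -/d.
have : 0 <= (s 0 i - s 0 j) / 2 * d.
  by rewrite mulr_ge0 ?(ltW d0) // divr_ge0 // subr_ge0.
have : 0 < c * d by rewrite mulr_gt0.
nra.
Qed.

End RiskMinimizer.

(** * Sums over top sets and discounted sums *)

(** The common part cancels, and [A :\: B] and [B :\: A] have equal size. Multiplying by that size
    turns both sides into sums over pairs, compared termwise. *)
Lemma top_set_sum_max (R : realDomainType) (T : finType) (f : T -> R)
    (A B : {set T}) :
  #|A| = #|B| -> (forall i j, i \in A -> j \notin A -> f j <= f i) ->
  \sum_(i in B) f i <= \sum_(i in A) f i.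
Proof.
move=> cAB topA.
rewrite (big_setID A) [leRHS](big_setID B) /= finset.setIC lerD2l.
have cD : #|A :\: B| = #|B :\: A|.
  by have := cardsID A B; rewrite -cAB -(cardsID B A) finset.setIC => /addnI.
have [AB0|[i0 i0A]] := set_0Vmem (A :\: B).
  have := cD; rewrite AB0 cards0 => /esym/eqP; rewrite cards_eq0 => /eqP ->.
  by rewrite !big_set0.
have n0 : 0 < #|A :\: B|%:R :> R.
  by rewrite ltr0n card_gt0; apply/set0Pn; exists i0.
rewrite -(ler_pM2l n0) [in leLHS]mulr_natl mulr_natl -sumr_const.
rewrite cD -sumr_const exchange_big /=; apply: ler_sum => j.
rewrite inE => /andP[jA _]; apply: ler_sum => i; rewrite inE => /andP[_ iA].
exact: topA.
Qed.

Lemma ordered_topk_bayes_optimal (R : realType) (C k : nat) (p : 'rV[R]_C)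
    (A : {set 'I_C}) :
  #|A| = k -> (forall i j, i \in A -> j \notin A -> p 0 j <= p 0 i) ->
  topk_bayes_optimal k p A.
Proof.
move=> cA topA; split=> // B cB.
have split_sum (D : {set 'I_C}) :
    topk_error p D = \sum_i p 0 i - \sum_(i in D) p 0 i.
  by rewrite (bigID (mem D)) /= addrAC subrr add0r.
by rewrite !split_sum lerB // top_set_sum_max // cA cB.
Qed.

(* Abel summation: with [D n] the partial sums of [d], the sum of the first [n]
   terms stays above [w n * D n]. *)
Lemma weighted_sum_ge0 (R : realDomainType) (C : nat) (d : 'I_C -> R)
    (w : nat -> R) :
  (forall n, 0 <= w n) -> (forall n, w n.+1 <= w n) ->
  (forall n, 0 <= \sum_(i < C | (i < n)%N) d i) ->
  0 <= \sum_(i < C) d i * w i.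
Proof.
move=> w0 wS d0.
have step n : (n <= C)%N ->
    w n * \sum_(i < C | (i < n)%N) d i <= \sum_(i < C | (i < n)%N) d i * w i.
  elim: n => [_|n IH nC]; first by rewrite !big_pred0_eq mulr0.
  have addS (F : 'I_C -> R) : \sum_(i < C | (i < n.+1)%N) F i =
      F (Ordinal nC) + \sum_(i < C | (i < n)%N) F i.
    rewrite (bigD1 (Ordinal nC)) //=; congr (_ + _); apply: eq_bigl => i.
    by rewrite ltnS -val_eqE /= andbC -ltn_neqAle.
  apply: (@le_trans _ _ (w n * \sum_(i < C | (i < n.+1)%N) d i)).
    exact: ler_wpM2r.
  by rewrite !addS mulrDr /= mulrC lerD2l; apply: IH; exact: ltnW.
have := step C (leqnn C).
under [X in _ <= X -> _]eq_bigl do rewrite ltn_ord.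
by apply: le_trans; exact: mulr_ge0.
Qed.

(** The first [n] ranks of [pi] form a top set of [p], so every partial sum of the differences is
    nonnegative; Abel summation with the decreasing discounts concludes. *)
Lemma sorted_perm_dcg_max (R : realType) (C : nat) (p : 'rV[R]_C)
    (pi rho : 'S_C) :
  sorts_nonincreasing p pi -> expected_dcg p rho <= expected_dcg p pi.
Proof.
move=> sorted_pi; rewrite -subr_ge0 /expected_dcg -sumrB.
pose w n : R := (log2 n.+2%:R)^-1.
have ln2 : 0 < ln (2 : R) by rewrite ln_gt0 // ltr1n.
have log_gt0 n : 0 < log2 (n.+2%:R : R).
  by rewrite divr_gt0 // ln_gt0 // ltr1n.
under eq_bigr do rewrite -mulrBl -/(w _).
apply: weighted_sum_ge0 => [n|n|n].
- by rewrite invr_ge0 ltW.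
- rewrite lef_pV2 ?posrE //; apply: ler_wpM2r; first by rewrite invr_ge0 ltW.
  by rewrite ler_ln ?posrE ?ltr0n // ler_nat.
rewrite sumrB subr_ge0; pose T := [set i : 'I_C | (i < n)%N].
have sumE (sigma : 'S_C) :
    \sum_(i < C | (i < n)%N) p 0 (sigma i) = \sum_(i in sigma @: T) p 0 i.
  rewrite big_imset /=; last by move=> ? ? _ _; exact: perm_inj.
  by apply: eq_bigl => i; rewrite inE.
rewrite !sumE; apply: top_set_sum_max.
  by rewrite !card_imset //; exact: perm_inj.
move=> _ j /imsetP[i iT ->]; rewrite -(permKV pi j) mem_imset;
  last exact: perm_inj.
rewrite !inE -leqNgt in iT * => nj; apply: sorted_pi.
exact: leq_trans (ltnW iT) nj.
Qed.

(** * From order of scores to calibration and consistency *)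

(** Used in both directions, the weak inequality makes tied scores come from tied probabilities, so
    any tie-breaking is correct. *)
Lemma order_reflecting_consistent (R : realType) (C : nat)
    (L : 'rV[R]_C -> 'rV[R]_C -> R) :
  (forall p s i j, prob_simplex R C p -> risk_minimizer L p s ->
    s 0 j <= s 0 i -> p 0 j <= p 0 i) ->
  (forall k, topk_calibrated k L) /\ dcg_consistent L.
Proof.
move=> ord; split=> [k p s pS smin A [cA topA]|p s pS smin pi sorted_pi rho].
  apply: ordered_topk_bayes_optimal => // i j iA jA.
  by apply: ord smin _ => //; exact: topA.
apply: sorted_perm_dcg_max => i j ij.
by apply: ord smin _ => //; exact: sorted_pi.
Qed.

Theorem proposition3p3 (R : realType) (C : nat) (hC : (2 <= C)%N)
    (L : 'rV[R]_C -> 'rV[R]_C -> R)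
    (hL : L = @sparsemax_loss R C \/
          exists alpha : R, 1 < alpha /\ L = @entmax_loss R C alpha) :
  (forall k : nat, (1 < k <= C)%N -> topk_calibrated k L) /\
  dcg_consistent L.
Proof.
suff ord p s i j : prob_simplex R C p -> risk_minimizer L p s ->
    s 0 j <= s 0 i -> p 0 j <= p 0 i.
  have [calibrated dcg] := order_reflecting_consistent ord.
  by split=> // k _; exact: calibrated.
case: hL => [->|[alpha [alpha1 ->]]].
  apply: (@risk_minimizer_order _ _ (fun x => 2^-1 * x ^+ 2) 0).
  - by move=> q; rewrite /half_sqnorm mulr_sumr.
  - by move=> x _; rewrite mulr_ge0 ?invr_ge0 ?sqr_ge0.
  - exact: midpoint_gap_sqr.
pose k : R := (alpha * (alpha - 1))^-1.
apply: (@risk_minimizer_order _ _ (fun x => k * (x `^ alpha - x)) (- k)).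
- by move=> q; rewrite /tsallis mulr_sumr.
- move=> x /andP[_ x1]; rewrite -mulrN1; apply: ler_wpM2l.
    by rewrite invr_ge0 mulr_ge0 //; lra.
  by have := powR_ge0 x alpha; lra.
- exact: midpoint_gap_tsallis.
Qed.
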